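(* Let $G$ be the compact simple Lie group of type $\mathrm G_2$ with maximal torus $T$ and Weyl group $W$, and let $V:T\to[0,\infty)$ be $V(t)=\prod_{\alpha}\sin^2(\alpha(\log t)/2)$, the product being over the positive roots. Then $V$ attains its maximum at a unique point of $T/W$; that is, the set of points of $T$ at which $V$ is maximal is a single $W$-orbit.
   Context: Roots are normalized as real linear functionals on the Lie algebra $\mathfrak t$ of $T$, so that $\mathrm{Ad}(\exp H)$ acts on the root plane of $\alpha$ as rotation by the angle $\alpha(H)$. The roots of $\mathrm G_2$ are, up to sign, the short roots $\theta_1,\theta_2,\theta_3$ and the long roots $\theta_1-\theta_2$, $\theta_2-\theta_3$, $\theta_3-\theta_1$, where $\theta_1+\theta_2+\theta_3=0$. Hence $$V(t)=\prod_{i=1}^3\sin^2(\theta_i/2)\cdot\prod_{1\le i<j\le3}\sin^2((\theta_i-\theta_j)/2),$$ with $\theta_i$ evaluated at $\log t$. The torus $T$ is $\{(\theta_1,\theta_2,\theta_3)\in(\mathbb R/2\pi\mathbb Z)^3:\theta_1+\theta_2+\theta_3=0\}$, and $W$ (of order 12) is generated by the permutations of $(\theta_1,\theta_2,\theta_3)$ and $-\mathrm{Id}$. Up to a constant factor $V(t)$ is the volume of the conjugacy class of $t$. *)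

(* Defs.v *)
From HB Require Import structures.
From mathcomp Require Import all_boot all_order all_fingroup all_algebra.
From mathcomp Require Import ring_quotient ring.
From mathcomp Require Import boolp classical_sets reals trigo.

Set Implicit Arguments.
Unset Strict Implicit.
Unset Printing Implicit Defensive.

Import Order.TTheory GRing.Theory Num.Theory.
Import Quotient.Exports.

Local Open Scope classical_set_scope.
Local Open Scope ring_scope.
Local Open Scope quotient_scope.

Definition two_piZ (R : realType) : {pred R} :=
  [pred x : R | `[< exists n : int, x = n%:~R * (2 * pi) >]].

Lemma two_piZ_zmod_closed (R : realType) : zmod_closed (@two_piZ R).
Proof.
split=> [|x y]; first by apply/asboolP; exists 0; rewrite mul0r.
move=> /asboolP[m ->] /asboolP[n ->]; apply/asboolP; exists (m - n).
by rewrite intrB mulrBl.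
Qed.

HB.instance Definition _ (R : realType) :=
  GRing.isZmodClosed.Build R (@two_piZ R) (@two_piZ_zmod_closed R).

Definition circle (R : realType) : zmodType := Quotient.quot (@two_piZ R).

Definition mod_two_pi (R : realType) (x : R) : circle R :=
  \pi_(Quotient.quot (@two_piZ R)) x.

Definition sum_zero (V : zmodType) : {pred 'rV[V]_3} :=
  [pred v : 'rV[V]_3 | \sum_i v 0 i == 0].

Lemma sum_zero_zmod_closed (V : zmodType) : zmod_closed (@sum_zero V).
Proof.
split=> [|u v]; first by apply/eqP/big1 => i _; rewrite mxE.
move=> /eqP u0 /eqP v0; apply/eqP.
under eq_bigr do rewrite !mxE.
by rewrite sumrB u0 v0 subrr.
Qed.

HB.instance Definition _ (V : zmodType) :=
  GRing.isZmodClosed.Build 'rV[V]_3 (@sum_zero V) (@sum_zero_zmod_closed V).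

Lemma sum_zero_scaler_closed (R : realType) : scaler_closed (@sum_zero R).
Proof.
move=> a v /eqP v0; apply/eqP.
under eq_bigr do rewrite mxE.
by rewrite -mulr_sumr v0 mulr0.
Qed.

HB.instance Definition _ (R : realType) :=
  GRing.isScaleClosed.Build R 'rV[R]_3 (@sum_zero R) (@sum_zero_scaler_closed R).

(* The maximal torus of the compact group of type G2. *)
Record torus (R : realType) := Torus {
  tval :> 'rV[circle R]_3;
  tvalP : tval \in @sum_zero (circle R) }.

HB.instance Definition _ (R : realType) := [isSub for @tval R].
HB.instance Definition _ (R : realType) := [Choice of torus R by <:].
HB.instance Definition _ (R : realType) :=
  [SubChoice_isSubZmodule of torus R by <:].

(* The Lie algebra of the torus. *)
Record cartan (R : realType) := Cartan {
  cval :> 'rV[R]_3;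
  cvalP : cval \in @sum_zero R }.

HB.instance Definition _ (R : realType) := [isSub for @cval R].
HB.instance Definition _ (R : realType) := [Choice of cartan R by <:].
HB.instance Definition _ (R : realType) :=
  [SubChoice_isSubZmodule of cartan R by <:].
HB.instance Definition _ (R : realType) :=
  [SubZmodule_isSubLmodule of cartan R by <:].

Lemma mod_two_pi_sum_zero (R : realType) (H : cartan R) :
  (\row_i mod_two_pi (H 0 i) : 'rV[circle R]_3) \in @sum_zero (circle R).
Proof.
apply/eqP; under eq_bigr do rewrite mxE.
have h0 : \sum_i H 0 i = 0 by exact/eqP/cvalP.
move: h0; rewrite !big_ord_recl !big_ord0 /mod_two_pi => h0.
transitivity (\pi_(Quotient.quot (@two_piZ R)) (0 : R)); last by rewrite piE.
by rewrite -h0 !piE.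
Qed.

Definition torus_exp (R : realType) (H : cartan R) : torus R :=
  Torus (mod_two_pi_sum_zero H).

(* A choice of preimage under torus_exp; see torus_logK. *)
Definition torus_log (R : realType) (t : torus R) : cartan R :=
  xget 0 [set H | torus_exp H = t].

Definition theta (R : realType) (i : 'I_3) (H : cartan R) : R := H 0 i.

Lemma theta_linear (R : realType) (i : 'I_3) :
  linear (theta i : cartan R -> R^o).
Proof. by move=> a H K; rewrite /theta !mxE. Qed.

Definition i1 : 'I_3 := @Ordinal 3 0 isT.
Definition i2 : 'I_3 := @Ordinal 3 1 isT.
Definition i3 : 'I_3 := @Ordinal 3 2 isT.

(* The short roots theta_1, theta_2, theta_3 sum to zero, so they are not all
   positive for any choice of positive system.  This is the positive system
   with simple roots theta_2 (short) and theta_1 - theta_2 (long). *)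
Definition positive_roots (R : realType) : seq (cartan R -> R) :=
  [:: theta i1; theta i2; (fun H => - theta i3 H);
      (fun H => theta i1 H - theta i2 H); (fun H => theta i2 H - theta i3 H);
      (fun H => theta i1 H - theta i3 H)].

Definition V (R : realType) (t : torus R) : R :=
  \prod_(alpha <- @positive_roots R) sin (alpha (torus_log t) / 2) ^+ 2.

Lemma perm_sum_zero (R : realType) (s : 'S_3) (t : torus R) :
  col_perm s t \in @sum_zero (circle R).
Proof.
apply/eqP; under eq_bigr do rewrite mxE.
by rewrite -(reindex_inj (h := s) perm_inj (P := xpredT) (F := fun i => t 0 i))
           //; exact/eqP/tvalP.
Qed.

Definition torus_perm (R : realType) (s : 'S_3) (t : torus R) : torus R :=
  Torus (perm_sum_zero s t).

(* All the generators have finite order, so closure under composition is enough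
   to obtain the group they generate. *)
Inductive weyl (R : realType) : (torus R -> torus R) -> Prop :=
| weyl_id : weyl id
| weyl_perm (s : 'S_3) w : weyl w -> weyl (@torus_perm R s \o w)
| weyl_opp w : weyl w -> weyl (-%R \o w).

Definition weyl_orbit (R : realType) (t : torus R) : set (torus R) :=
  [set u | exists2 w, weyl w & u = w t].

Lemma sum3 (U : zmodType) (f : 'I_3 -> U) : \sum_i f i = f i1 + f i2 + f i3.
Proof.
rewrite !big_ord_recl big_ord0 addr0 addrA.
by congr (f _ + f _ + f _); apply/val_inj.
Qed.

Lemma mod_two_pi_eq (R : realType) (x y : R) :
  mod_two_pi x = mod_two_pi y <-> exists n : int, x - y = n%:~R * (2 * pi).
Proof.
split=> [/eqP|[n e]].
  by rewrite /mod_two_pi -Quotient.idealrBE => /asboolP.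
by apply/eqP; rewrite /mod_two_pi -Quotient.idealrBE; apply/asboolP; exists n.
Qed.

Lemma torus_exp_surj (R : realType) (t : torus R) : exists H, torus_exp H = t.
Proof.
pose x i : R := generic_quotient.repr (t 0 i : Quotient.quot (@two_piZ R)).
have xK i : mod_two_pi (x i) = t 0 i by rewrite /mod_two_pi /x reprK.
pose v : 'rV[R]_3 := \row_i (if i == i3 then - (x i1 + x i2) else x i).
have v0 : v \in @sum_zero R by rewrite inE sum3 !mxE /= subrr.
exists (Cartan v0); apply/val_inj/rowP => i; rewrite !mxE /=.
case: eqP => [->|_]; last exact: xK.
have /eqP := tvalP t; rewrite sum3 => t0.
have -> : t 0 i3 = - (t 0 i1 + t 0 i2) by apply/eqP; rewrite -addr_eq0 addrC t0.
by rewrite -!xK /mod_two_pi !piE.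
Qed.

Lemma torus_logK (R : realType) (t : torus R) : torus_exp (torus_log t) = t.
Proof.
rewrite /torus_log; case: xgetP => [H _ //|no].
by have [H HE] := torus_exp_surj t; have := no H.
Qed.

Lemma sin2_periodic (R : realType) (x y : R) (n : int) :
  x - y = n%:~R * (2 * pi) -> sin (x / 2) ^+ 2 = sin (y / 2) ^+ 2.
Proof.
move=> e; have -> : x / 2 = y / 2 + pi *~ n.
  have -> : x = y + n%:~R * (2 * pi) by rewrite -e addrC subrK.
  by rewrite mulrDl -[_ * _ / 2]mulrA [2 * pi]mulrC mulfK ?pnatr_eq0 // mulrzl.
have sin2S z (m : nat) : sin (z + pi *+ m) ^+ 2 = sin z ^+ 2.
  elim: m => [|m IH]; first by rewrite mulr0n addr0.
  by rewrite mulrSr addrA sinDpi sqrrN.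
case: n {e} => m; first by rewrite -pmulrn sin2S.
by rewrite NegzE mulrNz -pmulrn -[in RHS](subrK (pi *+ m.+1) (y / 2)) sin2S.
Qed.

(* V does not depend on the choice of logarithm, and is given by the usual
   formula. *)
Lemma V_exp (R : realType) (H : cartan R) :
  V (torus_exp H) =
  sin (theta i1 H / 2) ^+ 2 * sin (theta i2 H / 2) ^+ 2 *
  sin (theta i3 H / 2) ^+ 2 *
  sin ((theta i1 H - theta i2 H) / 2) ^+ 2 *
  sin ((theta i2 H - theta i3 H) / 2) ^+ 2 *
  sin ((theta i1 H - theta i3 H) / 2) ^+ 2.
Proof.
pose L := torus_log (torus_exp H).
have thE i : exists n : int, theta i L - theta i H = n%:~R * (2 * pi).
  apply/mod_two_pi_eq.
  have /(congr1 (fun t : torus R => (t : 'rV_3) 0 i)) := torus_logK (torus_exp H).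
  by rewrite !mxE.
have s1 i : sin (theta i L / 2) ^+ 2 = sin (theta i H / 2) ^+ 2.
  by have [n /sin2_periodic] := thE i.
have s2 i j : sin ((theta i L - theta j L) / 2) ^+ 2 =
              sin ((theta i H - theta j H) / 2) ^+ 2.
  have [m em] := thE i; have [n en] := thE j.
  apply: (@sin2_periodic _ _ _ (m - n)).
  by rewrite intrB mulrBl -em -en; ring.
rewrite /V -/L /positive_roots !big_cons big_nil /= mulNr sinN sqrrN.
rewrite !s1 !s2; ring.
Qed.

(* Main.v *)
(* Put x = sum_i cos theta_i and u = 2 prod_i (1 - cos theta_i). Since
   theta_1 + theta_2 + theta_3 = 0, these two numbers determine all elementary
   symmetric functions of the cosines, and 1024 V is the polynomial
   u D(x, u), where D is the equation of the deltoid. For u >= 0 a sum-of-squares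
   identity bounds u D(x, u) by its value at the single point
   (x, u) = (-3/5, 36/25). The corresponding cosines are the roots of
   25 c^3 + 15 c^2 - 15 c - 7, so they are determined up to order, and the cosines
   determine (theta_1, theta_2, theta_3) mod 2 pi up to a global sign. *)
Require Import Defs.
From mathcomp Require Import all_boot all_order all_algebra.
From mathcomp Require Import classical_sets reals.
From mathcomp Require Import all_fingroup polydiv ring lra trigo.
Import Order.TTheory GRing.Theory Num.Theory.
Local Open Scope classical_set_scope.
Local Open Scope ring_scope.

Lemma sin_half_sqr (R : realType) (x : R) : sin (x / 2) ^+ 2 = (1 - cos x) / 2.
Proof.
have -> : cos x = cos ((x / 2) *+ 2) by rewrite -mulr_natr divfK ?pnatr_eq0.
by rewrite cos_mulr2n cos2sin2; lra.
Qed.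

(** The representative e of x - y in [0, 2 pi) satisfies sin (e / 2) ^+ 2 = (1 - cos (x - y)) / 2 =
    0, while the sine is positive on (0, pi). *)
Lemma cos_sin_eq_mod_two_pi (R : realType) (x y : R) :
  cos x = cos y -> sin x = sin y -> mod_two_pi x = mod_two_pi y.
Proof.
move=> cxy sxy; apply/mod_two_pi_eq.
have pi2_gt0 : 0 < 2 * pi :> R by rewrite mulr_gt0 ?pi_gt0.
set d := x - y; pose n := Num.floor (d / (2 * pi)); exists n.
pose e := d - n%:~R * (2 * pi).
suff e0 : e = 0 by apply/eqP; rewrite -subr_eq0 -/e e0.
have se0 : sin (e / 2) ^+ 2 = 0.
  rewrite -(@sin2_periodic R d e n); last by rewrite /e opprB addrC subrK.
  by rewrite sin_half_sqr cosB cxy sxy -!expr2 cos2Dsin2 subrr mul0r.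
have /andP[e_ge0 e_lt] : 0 <= e < 2 * pi.
  have := floor_itv (d / (2 * pi)); rewrite -/n intrD mulr1z.
  rewrite ler_pdivlMr // ltr_pdivrMr // => /andP[h1 h2].
  by apply/andP; split; rewrite /e; lra.
move: e_ge0; rewrite le_eqVlt => /predU1P[//|e_gt0].
have : 0 < sin (e / 2) by apply: sin_gt0_pi; apply/andP; split; lra.
by move/eqP: se0; rewrite sqrf_eq0 => /eqP ->; rewrite ltxx.
Qed.

(** * Cosines of three angles with zero sum *)

Section Cosines.
Variable R : realType.
Implicit Types H K : cartan R.

Definition cos_sum H : R := \sum_i cos (theta i H).
Definition cos_coprod H : R := \prod_i (1 - cos (theta i H)).

Lemma prod3 (A : pzRingType) (f : 'I_3 -> A) : \prod_i f i = f i1 * f i2 * f i3.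
Proof.
rewrite !big_ord_recl big_ord0 mulr1 mulrA.
by congr (f _ * f _ * f _); apply/val_inj.
Qed.

Lemma theta_sum0 H : theta i1 H + theta i2 H + theta i3 H = 0.
Proof. by have /eqP := cvalP H; rewrite sum3. Qed.

Lemma ord3_ind (P : 'I_3 -> Prop) : P i1 -> P i2 -> P i3 -> forall i, P i.
Proof.
move=> P1 P2 P3 [[|[|[|//]]] lti].
- by rewrite (_ : Ordinal lti = i1) //; apply/val_inj.
- by rewrite (_ : Ordinal lti = i2) //; apply/val_inj.
- by rewrite (_ : Ordinal lti = i3) //; apply/val_inj.
Qed.

Lemma cosD_theta H :
  [/\ cos (theta i1 H + theta i2 H) = cos (theta i3 H),
      cos (theta i2 H + theta i3 H) = cos (theta i1 H) &
      cos (theta i1 H + theta i3 H) = cos (theta i2 H)].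
Proof.
have h := theta_sum0 H.
split; rewrite -[RHS]cosN; congr cos; apply/eqP; rewrite -subr_eq0 opprK -h;
  apply/eqP; ring.
Qed.

Lemma sinM_theta H :
  let c i := cos (theta i H) in let s i := sin (theta i H) in
  [/\ s i1 * s i2 = c i1 * c i2 - c i3, s i2 * s i3 = c i2 * c i3 - c i1 &
      s i1 * s i3 = c i1 * c i3 - c i2].
Proof.
have [h3 h1 h2] := cosD_theta H.
by split=> /=; [rewrite -h3 | rewrite -h1 | rewrite -h2]; rewrite cosD subKr.
Qed.

Lemma cos_theta_rel H :
  let c i := cos (theta i H) in
  c i1 ^+ 2 + c i2 ^+ 2 + c i3 ^+ 2 = 1 + 2 * (c i1 * c i2 * c i3).
Proof.
move=> c; have [h _ _] := sinM_theta H.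
have : (sin (theta i1 H) * sin (theta i2 H)) ^+ 2 =
       (c i1 * c i2 - c i3) ^+ 2 by rewrite h.
rewrite exprMn !sin2cos2 -/(c i1) -/(c i2); move: (c i1) (c i2) (c i3) => x y z.
by move=> e; lra.
Qed.

(* Minus the discriminant of z^3 - tau z^2 + conj(tau) z - 1, the polynomial with roots
   exp(i theta_j), where x is the real part of tau and u is the square of its
   imaginary part. *)
Definition deltoid (x u : R) : R :=
  27 - 18 * x ^+ 2 - 18 * u + 8 * x ^+ 3 - 24 * x * u - x ^+ 4
  - 2 * x ^+ 2 * u - u ^+ 2.

(** Sines enter V only through products of two, which [sinM_theta] turns into polynomials in the
    cosines; [cos_theta_rel] then eliminates e3. *)
Lemma V_deltoid H : let u := 2 * cos_coprod H in
  V (torus_exp H) = u * deltoid (cos_sum H) u / 1024.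
Proof.
move=> u; rewrite V_exp !sin_half_sqr !cosB.
have [-> -> ->] := sinM_theta H.
rewrite /u /cos_coprod /cos_sum sum3 prod3.
have := cos_theta_rel H; rewrite /=.
move: (cos (theta i1 H)) (cos (theta i2 H)) (cos (theta i3 H)) => a b c rel.
pose e1 := a + b + c; pose e2 := a * b + b * c + a * c; pose e3 := a * b * c.
have e3E : e3 = (e1 ^+ 2 - 2 * e2 - 1) / 2.
  by rewrite /e1 /e2 /e3; lra.
have -> : (1 - a) * (1 - b) * (1 - c) = 1 - e1 + e2 - e3.
  by rewrite /e1 /e2 /e3; ring.
rewrite -/e1.
(* The last factor expands the product of the 1 - cos (theta_i - theta_j) = 1 + c_k - 2 c_i c_j. *)
transitivity ((1 - e1 + e2 - e3) / 64 *
  (1 + e1 + e2 + e3 - 2 * (e2 + e1 * e2 - 3 * e3 + e2 ^+ 2 - 2 * e1 * e3)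
   + 4 * e3 * (e1 + e1 ^+ 2 - 2 * e2) - 8 * e3 ^+ 2)).
  by rewrite /e1 /e2 /e3; field.
rewrite e3E /deltoid; move: e1 e2 {e3 e3E} => e1 e2.
by field.
Qed.

(** * Maximizing u D(x, u) for u >= 0 *)

Definition max_u : R := 36 / 25.
Definition max_x : R := - 3 / 5.

Lemma deltoid_bound (x u : R) : 0 <= u ->
  let M := max_u * deltoid max_x max_u in
  u * deltoid x u <= M /\ (u * deltoid x u = M -> x = max_x /\ u = max_u).
Proof.
move=> u_ge0 M.
(* k is linear in u with x ^+ 2 - 4 * x + k = 0 at the maximum; the slope -9/10
   is one for which the residual factor q has no real zero. *)
pose k := - 183 / 125 - 9 / 10 * u; pose A := 1 + u - k.
pose q := (361 * u ^+ 2 - (4579 + 1 / 25) * u + 16 * 9 * (123 + 1 / 5)) / 1000.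
have A_gt0 : 0 < A by rewrite /A /k; lra.
have q_gt0 : 0 < q.
  (* For u >= 0, 1000 q exceeds this square. *)
  by have := sqr_ge0 (19 * u - 121); rewrite /q; lra.
(* Adding (x^2 - 4 x + k)^2 to [deltoid x u] cancels the terms in x^4 and x^3. Completing the square
   in the remaining quadratic, of leading coefficient -2 A, leaves a polynomial in u with a double
   zero at [max_u]. *)
have sos : 2 * A * (M - u * deltoid x u) =
    2 * A * u * (x ^+ 2 - 4 * x + k) ^+ 2
    + u * (2 * A * x + 4 * (3 * u + k)) ^+ 2 + 2 * (u - max_u) ^+ 2 * q.
  by rewrite /M /q /A /k /deltoid /max_u /max_x; field.
have t1 : 0 <= 2 * A * u * (x ^+ 2 - 4 * x + k) ^+ 2.
  by rewrite mulr_ge0 ?sqr_ge0 // mulr_ge0 // mulr_ge0 // ltW.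
have t2 : 0 <= u * (2 * A * x + 4 * (3 * u + k)) ^+ 2.
  by rewrite mulr_ge0 ?sqr_ge0.
have t3 : 0 <= 2 * (u - max_u) ^+ 2 * q.
  by rewrite mulr_ge0 ?(ltW q_gt0) // mulr_ge0 ?sqr_ge0.
split=> [|e].
  rewrite -subr_ge0 -(pmulr_rge0 _ (_ : 0 < 2 * A)) ?sos ?mulr_gt0 //.
  by rewrite !addr_ge0.
move: sos; rewrite e subrr mulr0 => sos.
have u_max : u = max_u.
  have : 2 * (u - max_u) ^+ 2 * q = 0 by lra.
  move/eqP; rewrite mulf_eq0 (gt_eqF q_gt0) orbF mulf_eq0 pnatr_eq0 sqrf_eq0 subr_eq0.
  by move/eqP.
split=> //.
have : u * (2 * A * x + 4 * (3 * u + k)) ^+ 2 = 0 by lra.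
move/eqP; rewrite mulf_eq0 sqrf_eq0.
by rewrite /A /k u_max /max_u /max_x => /orP[] /eqP; lra.
Qed.

(** Sign changes of the cubic between -1, -1/2 and 0 locate a and b; the sum of the roots gives c.
    The bounds on a and b serve [acos], whereas c will arise as the cosine of a sum. *)
Lemma exists_cubic_roots : exists a b c : R,
  [/\ -1 <= a <= 1, -1 <= b <= 1, a + b + c = - 3 / 5,
      a * b + b * c + a * c = - 3 / 5 & a * b * c = 7 / 25].
Proof.
pose p : {poly R} := 25%:P * 'X^3 + 15%:P * 'X^2 - 15%:P * 'X - 7%:P.
have pE x : p.[x] = 25 * x ^+ 3 + 15 * x ^+ 2 - 15 * x - 7.
  by rewrite /p !(hornerE, hornerXn).
have [||a /andP[a1 a2] /rootP] := @poly_ivt R p (-1) (- 1 / 2).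
- by lra.
- by rewrite !pE; apply/andP; split; lra.
rewrite pE => pa.
have [||b /andP[b1 b2] /rootP] := @poly_ivt R (- p) (- 1 / 2) 0.
- by lra.
- by rewrite !hornerN !pE; apply/andP; split; lra.
rewrite hornerN pE => /eqP; rewrite oppr_eq0 => /eqP pb.
(* This is the divided difference of p at a and b; a = b would force both to be -1/2, which is not a
   root. *)
have pab : 25 * (a ^+ 2 + a * b + b ^+ 2) + 15 * (a + b) - 15 = 0.
  have a_neq_b : a - b != 0.
    rewrite subr_eq0; apply/negP => /eqP ab.
    have bE : b = - 1 / 2 by lra.
    by move: pb; rewrite bE; lra.
  apply: (mulfI a_neq_b); rewrite mulr0 -[RHS](subrr 0) -{1}pa -pb; ring.
exists a, b, (- 3 / 5 - a - b); split; try by (apply/andP; split; lra).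
- by ring.
- by lra.
- have -> : a * b * (- 3 / 5 - a - b) =
      a ^+ 3 + 3 / 5 * a ^+ 2 - a / 25 * (25 * (a ^+ 2 + a * b + b ^+ 2)
      + 15 * (a + b) - 15) - 3 / 5 * a by field.
  by rewrite pab; lra.
Qed.

Definition critical H := cos_sum H = max_x /\ 2 * cos_coprod H = max_u.

(** The symmetric functions of a, b, c give (1 - a^2) (1 - b^2) = (a b - c)^2, so one of the two
    signs in z = ± acos b makes cos (y + z) equal to c. *)
Lemma critical_exists : exists H, critical H.
Proof.
have [a [b [c [a_itv b_itv s1 s2 s3]]]] := exists_cubic_roots.
pose y := acos a.
have [z cz cyz] : exists2 z, cos z = b & cos (y + z) = c.
  have cosDy z : cos z = b -> sin y * sin z = a * b - c -> cos (y + z) = c.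
    by move=> cz h; rewrite cosD acosK // cz h subKr.
  have sinM : (sin y * sin (acos b)) ^+ 2 = (a * b - c) ^+ 2.
    rewrite exprMn !sin2cos2 !acosK //.
    have cE : c = - 3 / 5 - a - b by lra.
    by subst c; lra.
  have : sin y * sin (acos b) = a * b - c \/ sin y * sin (- acos b) = a * b - c.
    move/eqP: sinM; rewrite eqf_sqr => /orP[] /eqP e; [left|right] => //.
    by rewrite sinN mulrN e opprK.
  by case=> e; [exists (acos b) | exists (- acos b)];
    rewrite ?cosN ?acosK ?(cosDy _ _ e) ?cosN ?acosK.
pose v : 'rV[R]_3 := \row_i [:: y; z; - (y + z)]`_i.
have v0 : v \in @sum_zero R by rewrite inE sum3 !mxE /= subrr.
exists (Cartan v0); rewrite /critical /cos_sum /cos_coprod sum3 prod3 /theta !mxE /=.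
rewrite cosN cyz cz acosK // /max_x /max_u s1; split=> //.
have -> : (1 - a) * (1 - b) * (1 - c) =
  1 - (a + b + c) + (a * b + b * c + a * c) - a * b * c by ring.
by rewrite s1 s2 s3; lra.
Qed.

Lemma cos_coprod_ge0 H : 0 <= cos_coprod H.
Proof. by apply: prodr_ge0 => i _; rewrite subr_ge0 cos_le1. Qed.

(** By [critical_exists] the bound M is attained, so a maximizer reaches equality in
    [deltoid_bound]. *)
Lemma V_max_critical H :
  (forall s : torus R, V s <= V (torus_exp H)) <-> critical H.
Proof.
pose M := max_u * deltoid max_x max_u / 1024.
have V_le K : V (torus_exp K) <= M.
  rewrite V_deltoid ler_pM2r ?invr_gt0 //.
  by apply: (deltoid_bound _ _ _).1; rewrite mulr_ge0 ?cos_coprod_ge0.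
have V_crit K : critical K -> V (torus_exp K) = M.
  by case=> xK uK; rewrite V_deltoid xK uK.
split=> [maxH|/V_crit -> s]; last by have [K <-] := torus_exp_surj s.
have [K critK] := critical_exists.
have : V (torus_exp H) = M.
  by apply/le_anti; rewrite V_le -(V_crit K critK) maxH.
rewrite V_deltoid => /(divIf _) e.
apply: (deltoid_bound _ _ _).2; first by rewrite mulr_ge0 ?cos_coprod_ge0.
by apply: e; rewrite pnatr_eq0.
Qed.

(** * Weyl group action on critical points *)

Lemma cartan_perm_subproof (s : 'S_3) H : col_perm s H \in @sum_zero R.
Proof.
apply/eqP; under eq_bigr do rewrite mxE.
by rewrite -(reindex_inj perm_inj (P := xpredT) (F := fun i => H 0 i));
   exact/eqP/cvalP.
Qed.

Definition cartan_perm (s : 'S_3) H : cartan R := Cartan (cartan_perm_subproof s H).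

Lemma theta_perm s H i : theta i (cartan_perm s H) = theta (s i) H.
Proof. by rewrite /theta !mxE. Qed.

Lemma theta_opp H i : theta i (- H) = - theta i H.
Proof. by rewrite /theta !mxE. Qed.

Lemma torus_exp_perm s H : torus_exp (cartan_perm s H) = torus_perm s (torus_exp H).
Proof. by apply/val_inj/rowP => i; rewrite !mxE. Qed.

Lemma torus_exp_opp H : torus_exp (- H) = - torus_exp H.
Proof. by apply/val_inj/rowP => i; rewrite !mxE /mod_two_pi !piE. Qed.

Lemma critical_perm s H : critical H -> critical (cartan_perm s H).
Proof.
case=> xH uH; split; [rewrite -xH | rewrite -uH; congr (2 * _)];
  rewrite [RHS](reindex_inj (@perm_inj _ s));
  by apply: eq_bigr => i _; rewrite theta_perm.
Qed.

Lemma critical_opp H : critical H -> critical (- H).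
Proof.
rewrite /critical /cos_sum /cos_coprod => -[<- <-].
by split; [|congr (2 * _)]; apply: eq_bigr => i _; rewrite theta_opp cosN.
Qed.

Lemma critical_weyl w H : weyl w -> critical H ->
  exists2 K, critical K & w (torus_exp H) = torus_exp K.
Proof.
move=> ww cH; elim: ww => [|s {}w _ [K cK wE]|{}w _ [K cK wE]]; first by exists H.
- by exists (cartan_perm s K); [exact: critical_perm | rewrite torus_exp_perm -wE].
- by exists (- K); [exact: critical_opp | rewrite torus_exp_opp -wE].
Qed.

(** A vanishing sine means c1 = 1, so that [cos_coprod H] is 0, or c1 = -1, so that [cos_theta_rel]
    gives c2 + c3 = 0 and [cos_sum H] is -1. *)
Lemma critical_sin_neq0 H : critical H -> sin (theta i1 H) != 0.
Proof.
case; rewrite /cos_sum /cos_coprod sum3 prod3 /max_x /max_u => xH uH.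
have rel := cos_theta_rel H; apply/eqP => s0.
have := cos2Dsin2 (theta i1 H); rewrite s0 expr0n addr0 => /eqP.
rewrite sqrf_eq1 => /orP[] /eqP c1; move: rel xH uH; rewrite /= c1.
- by rewrite subrr !mul0r; lra.
- move: (cos _) (cos _) => b c rel xH.
  have bc : (b + c) ^+ 2 = 0 by lra.
  by move/eqP: bc; rewrite sqrf_eq0 => /eqP; lra.
Qed.

(* Products of two distinct sines are polynomials in the cosines, so the signs
   relating the sines of H to those of K all coincide. *)
Lemma torus_exp_eq_or_opp H K : (forall i, cos (theta i H) = cos (theta i K)) ->
  sin (theta i1 K) != 0 -> torus_exp H = torus_exp K \/ torus_exp H = - torus_exp K.
Proof.
move=> cHK s_neq0.
have [h12 _ h13] := sinM_theta H; have [k12 _ k13] := sinM_theta K.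
have e12 : sin (theta i1 H) * sin (theta i2 H) = sin (theta i1 K) * sin (theta i2 K).
  by rewrite h12 k12 !cHK.
have e13 : sin (theta i1 H) * sin (theta i3 H) = sin (theta i1 K) * sin (theta i3 K).
  by rewrite h13 k13 !cHK.
have exp_eq L : (forall i, cos (theta i H) = cos (theta i L)) ->
    (forall i, sin (theta i H) = sin (theta i L)) -> torus_exp H = torus_exp L.
  move=> c s; apply/val_inj/rowP => i; rewrite !mxE.
  exact: (cos_sin_eq_mod_two_pi _ _ _ (c i) (s i)).
have : sin (theta i1 H) ^+ 2 == sin (theta i1 K) ^+ 2 by rewrite !sin2cos2 cHK.
rewrite eqf_sqr => /orP[] /eqP e; [left|right; rewrite -torus_exp_opp].
- by apply: exp_eq => //; apply: ord3_ind => //; apply: (mulfI s_neq0); rewrite -{1}e.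
- apply: exp_eq => i; first by rewrite theta_opp cosN.
  rewrite theta_opp sinN; move: i; apply: ord3_ind => //; apply: (mulfI s_neq0);
    by rewrite mulrN -?e12 -?e13 e mulNr opprK.
Qed.

(** Both triples of cosines are the roots, with multiplicity, of one monic cubic. *)
Lemma critical_cos_perm H K : critical H -> critical K ->
  exists s : 'S_3, forall i, cos (theta i H) = cos (theta (s i) K).
Proof.
move=> [xH uH] [xK uK].
pose t (L : cartan R) := [tuple cos (theta i L) | i < 3].
suff : perm_eq (t H) (t K).
  move=> /tuple_permP[s e]; exists s => i.
  have /(congr1 (fun r => tnth r i)) : t H = [tuple tnth (t K) (s i) | i < 3].
    exact/val_inj.
  by rewrite !tnth_mktuple.
have symE L : critical L -> let c i := cos (theta i L) in
    c i1 * c i2 + c i2 * c i3 + c i1 * c i3 = - 3 / 5 /\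
    c i1 * c i2 * c i3 = 7 / 25.
  case; have := cos_theta_rel L; rewrite /cos_sum /cos_coprod sum3 prod3 /=.
  move: (cos (theta i1 L)) (cos (theta i2 L)) (cos (theta i3 L)) => a b c.
  rewrite /max_x /max_u => rel s1 u.
  (* Given the sum of the cosines, [rel] fixes e2 + e3 and [u] fixes e2 - e3. *)
  have cE : c = - 3 / 5 - a - b by lra.
  by subst c; split; lra.
have cubicE L : critical L -> \prod_(x <- t L) ('X - x%:P) =
    'X^3 - max_x%:P * 'X^2 + (- 3 / 5)%:P * 'X - (7 / 25)%:P.
  move=> cL; have [<- <-] := symE L cL; case: cL => <- _.
  rewrite big_tuple; under eq_bigr do rewrite tnth_mktuple.
  rewrite /cos_sum sum3 prod3.
  move: (cos (theta i1 L)) (cos (theta i2 L)) (cos (theta i3 L)) => a b c.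
  by rewrite !polyCD !polyCM; ring.
by apply: prod_XsubC_eq; rewrite !cubicE.
Qed.

End Cosines.

Theorem corollary7p4 (R : realType) :
  exists t0 : torus R,
    [set t : torus R | forall s : torus R, V s <= V t] = weyl_orbit t0.
Proof.
have [K cK] := critical_exists R.
exists (torus_exp K); apply/seteqP; split=> t /=.
- have [H <-] := torus_exp_surj t => /V_max_critical cH.
  have [s cosE] := critical_cos_perm _ _ _ cH cK.
  (* Once K is permuted, the cosines agree index by index and only a global sign remains. *)
  have cosE' i : cos (theta i H) = cos (theta i (cartan_perm _ s K)).
    by rewrite theta_perm.
  have s0 := critical_sin_neq0 _ _ (critical_perm _ s _ cK).
  case: (torus_exp_eq_or_opp _ _ _ cosE' s0) => ->; rewrite torus_exp_perm.
  + exists (torus_perm s \o id) => //.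
    exact/weyl_perm/weyl_id.
  + exists (-%R \o (torus_perm s \o id)) => //.
    exact/weyl_opp/weyl_perm/weyl_id.
- case=> w ww ->; have [L cL ->] := critical_weyl _ _ _ ww cK.
  exact/V_max_critical.
Qed.
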